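(* Let a random directed graph on $\mathbb{Z}$, all of whose edges $(i,j)$ satisfy $i<j$, have a law that is invariant and ergodic under integer translations, and let $\mathscr{S}$ be its skeleton. Assume $\mathbb{P}(0\in\mathscr{S})>0$, and enumerate the elements of $\mathscr{S}$ as $\cdots<\Gamma_{-1}<\Gamma_0\le 0<\Gamma_1<\Gamma_2<\cdots$. Then, almost surely, for all integers $m<n$, $$L[\Gamma_m,\Gamma_n]=L[\Gamma_m,\Gamma_{m+1}]+\cdots+L[\Gamma_{n-1},\Gamma_n].$$
   Context: A path is an increasing sequence $i_0<i_1<\cdots<i_\ell$ of integers with every $(i_{s-1},i_s)$ an edge; its length is $\ell$. Write $i\leadsto j$ (for $i<j$) if there is a path from $i$ to $j$. $L[i,j]$ is the maximum length of all paths with all vertices in $\{i,\ldots,j\}$ (equal to $0$ if there is no edge). The skeleton $\mathscr{S}$ is the random set of $n\in\mathbb{Z}$ such that $n\leadsto j$ for all $j>n$ and $j\leadsto n$ for all $j<n$. Under the stated assumption $\mathscr{S}$ is a.s. unbounded in both directions. The underlying probability space is the space of edge configurations $(\alpha_{i,j})_{i<j}\in\{-\infty,1\}^{\{i<j\}}$ ($\alpha_{i,j}=1$ meaning that $(i,j)$ is an edge), with shift $\theta$ given by $\alpha_{i,j}(\theta\omega)=\alpha_{i+1,j+1}(\omega)$; invariance and ergodicity are with respect to $\theta$. *)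

(* Defs.v *)
From HB Require Import structures.
From mathcomp Require Import all_boot all_order all_algebra.
From mathcomp Require Import all_classical all_reals all_analysis.

Set Implicit Arguments.
Unset Strict Implicit.
Unset Printing Implicit Defensive.

Import Order.TTheory GRing.Theory Num.Theory.

Local Open Scope classical_set_scope.
Local Open Scope ring_scope.

Definition edge_index := {e : int * int | e.1 < e.2}.

(* The two edge weights are encoded as booleans: [w (i, j) = true] stands for
   weight 1 (an edge from i to j) and [false] for weight -oo (no edge). *)
Definition config := edge_index -> bool.

(* These events generate the product sigma-algebra on configurations. *)
Definition edge_events : set (set config) :=
  [set [set w : config | w e] | e in [set: edge_index]].

Definition config_space := g_sigma_algebraType edge_events.

Lemma shift_index_subproof (e : edge_index) :
  ((val e).1 + 1, (val e).2 + 1).1 < ((val e).1 + 1, (val e).2 + 1).2.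
Proof. by rewrite /= ltrD2r (valP e). Qed.

Definition shift_index (e : edge_index) : edge_index :=
  exist _ ((val e).1 + 1, (val e).2 + 1) (shift_index_subproof e).

Definition shift (w : config_space) : config_space := w \o shift_index.

Definition shift_invariant (R : realType) (P : probability config_space R) :=
  forall A : set config_space, measurable A -> P (shift @^-1` A) = P A.

Definition shift_ergodic (R : realType) (P : probability config_space R) :=
  forall A : set config_space, measurable A -> shift @^-1` A = A ->
    P A = 0%E \/ P A = 1%E.

Section Graph.
Variable w : config.

(* Pairs with j <= i are never edges, so that [path edge] only accepts
   strictly increasing sequences. *)
Definition edge (i j : int) : bool :=
  if insub (i, j) is Some e then w e else false.

(* A path i_0 < i_1 < ... < i_l is given by its first vertex i_0 and the
   sequence [:: i_1; ...; i_l], whose size is the length of the path. *)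
Definition leads (i j : int) : Prop :=
  exists s : seq int, path edge i s /\ last i s = j.

Definition skeleton : set int :=
  [set n | (forall j, n < j -> leads n j) /\ (forall j, j < n -> leads j n)].

Definition path_lengths (i j : int) : set nat :=
  [set size s | s in [set s | exists i0 : int,
     path edge i0 s /\ all (fun k => i <= k <= j) (i0 :: s)]].

(* The maximum of [path_lengths i j], which exists as soon as i <= j; see
   [longestP]. *)
Definition longest (i j : int) : nat :=
  xget 0%N (path_lengths i j `&` ubound (path_lengths i j)).

Definition skeleton_enum (G : int -> int) : Prop :=
  [/\ {homo G : m n / m < n}, range G = skeleton & G 0 <= 0 < G 1].

End Graph.

Lemma edgeE (w : config) (i j : int) (ij : i < j) :
  edge w i j = w (exist _ (i, j) ij).
Proof.
rewrite /edge; case: insubP => [e _ ve|]; last by rewrite ij.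
by congr w; apply: val_inj.
Qed.

Lemma edge_lt (w : config) (i j : int) : edge w i j -> i < j.
Proof. by rewrite /edge; case: insubP. Qed.

Lemma path_size_le (w : config) (i : int) (s : seq int) :
  path (edge w) i s -> i + (size s)%:Z <= last i s.
Proof.
elim: s i => [|k s IHs] i /=; first by rewrite addr0.
case/andP => /edge_lt ik /IHs; apply: le_trans.
by rewrite -add1n PoszD addrA lerD2r lezD1.
Qed.

Lemma longestP (w : config) (i j : int) : i <= j ->
  path_lengths w i j (longest w i j) /\
  ubound (path_lengths w i j) (longest w i j).
Proof.
move=> ij; rewrite /longest.
set A := path_lengths w i j.
have A0 : A 0%N by exists [::] => //; exists i; rewrite /= lexx ij.
have Aub l : A l -> (l <= `|j - i|)%N.
  move=> [s [i0 [ps /allP sij]] <-].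
  have /andP[i0i _] : i <= i0 <= j by apply: sij; rewrite mem_head.
  have /andP[_ lj] : i <= last i0 s <= j by apply: sij; rewrite mem_last.
  rewrite -lez_nat gez0_abs ?subr_ge0// lerBrDl.
  by apply: le_trans lj; apply: le_trans (path_size_le ps); rewrite lerD2r.
have exA : exists l, `[< A l >] by exists 0%N; apply/asboolP.
have bA l : `[< A l >] -> (l <= `|j - i|)%N by move/asboolP; exact: Aub.
case: (ex_maxnP exA bA) => l /asboolP Al lmax.
suff : (A `&` ubound A) l by exact: xgetI.
by split=> // k Ak; rewrite leEnat; apply: lmax; apply/asboolP.
Qed.

Lemma measurable_edge (i j : int) :
  measurable [set w : config_space | edge w i j].
Proof.
have [ij|ji] := ltP i j; last first.
  rewrite (_ : [set _ | _] = set0); first exact: measurable0.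
  by apply/seteqP; split=> // w /edge_lt; rewrite ltNge ji.
apply: sub_sigma_algebra; exists (exist _ (i, j) ij) => //.
by apply/seteqP; split=> w /=; rewrite (edgeE _ ij).
Qed.

Lemma measurable_path (i : int) (s : seq int) :
  measurable [set w : config_space | path (edge w) i s].
Proof.
elim: s i => [|k s IHs] i /=.
  by rewrite (_ : [set _ | _] = setT) //; apply/seteqP; split.
rewrite (_ : [set _ | _] = [set w : config_space | edge w i k] `&`
                           [set w : config_space | path (edge w) k s]).
  exact: measurableI (measurable_edge i k) (IHs k).
by apply/seteqP; split=> w /= => [/andP[]|[-> ->]].
Qed.

Lemma measurable_leads (i j : int) :
  measurable [set w : config_space | leads w i j].
Proof.
rewrite (_ : [set _ | _] =
  \bigcup_s [set w : config_space | path (edge w) i s /\ last i s = j]).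
  apply: countable_bigcupT_measurable => // s.
  have [sj|sj] := eqVneq (last i s) j.
    rewrite (_ : [set _ | _] = [set w : config_space | path (edge w) i s]).
      exact: measurable_path.
    by apply/seteqP; split=> w /= => [[]|].
  rewrite (_ : [set _ | _] = set0); first exact: measurable0.
  by apply/seteqP; split=> w //= [_ /eqP]; rewrite (negbTE sj).
by apply/seteqP; split=> w /= [s]; exists s.
Qed.

Lemma measurable_skeleton (n : int) :
  measurable [set w : config_space | skeleton w n].
Proof.
pose A j := [set w : config_space | n < j -> leads w n j].
pose B j := [set w : config_space | j < n -> leads w j n].
have mimp (b : bool) (C : set config_space) :
    measurable C -> measurable [set w | b -> C w].
  case: b => mC.
    rewrite (_ : [set _ | _] = C) //.
    by apply/seteqP; split=> w /= => [/(_ isT)|].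
  rewrite (_ : [set _ | _] = setT) //.
  by apply/seteqP; split.
rewrite (_ : [set _ | _] = ~` (\bigcup_j ~` A j) `&` ~` (\bigcup_j ~` B j)).
  apply: measurableI; apply: measurableC.
    apply: countable_bigcupT_measurable => [|j]; first exact: countableP.
    by apply: measurableC; apply: mimp; exact: measurable_leads.
  apply: countable_bigcupT_measurable => [|j]; first exact: countableP.
  by apply: measurableC; apply: mimp; exact: measurable_leads.
apply/seteqP; split=> w.
  by move=> [Aw Bw]; split=> -[j _]; apply; [exact: Aw|exact: Bw].
by rewrite !setC_bigcup => -[Aw Bw]; split=> j; [have := Aw j I|have := Bw j I];
  rewrite setCK.
Qed.

(* Main.v *)
(** The additivity is deterministic. Every vertex leads to a skeleton point [x]
    or is reached from it, so a longest path in [[a, x]] must end at [x] and a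
    longest path in [[x, b]] must start at [x]; concatenating them gives
    [L[a, x] + L[x, b] <= L[a, b]]. Conversely a path in [[a, b]] that avoids
    [x] can be rerouted through [x] without getting shorter.

    Probability only enters to show that the skeleton is unbounded in both
    directions: the event that it is unbounded above is shift invariant and is
    a decreasing limit of events of probability at least [P (0 \in S) > 0], so
    by ergodicity it has probability 1; the same holds below. *)
Require Import Defs.
From mathcomp Require Import all_boot all_order all_algebra.
From mathcomp Require Import all_classical all_reals all_analysis.
From mathcomp Require Import zify.

Set Implicit Arguments.
Unset Strict Implicit.

Import Order.TTheory GRing.Theory Num.Theory.

Local Open Scope classical_set_scope.
Local Open Scope ring_scope.

(** * Paths and longest paths in an interval *)

Lemma path_confined (w : config) (i : int) (s : seq int) : path (edge w) i s ->
  all (fun k => i <= k <= last i s) (i :: s).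
Proof.
elim: s i => [|k s IHs] i; first by rewrite /= lexx.
rewrite [path _ _ _]/= => /andP[/edge_lt ik /IHs ks].
have /andP[/andP[_ kl] _] := ks.
rewrite (last_cons i) [all _ _]/= lexx (le_trans (ltW ik) kl).
apply: sub_all ks => z /andP[kz ->].
by rewrite (le_trans (ltW ik) kz).
Qed.

(** Paths increase, so only the two end vertices need to be compared with [a] and [b]. *)
Lemma path_lengths_size (w : config) (a b i : int) (s : seq int) :
  path (edge w) i s -> a <= i -> last i s <= b -> path_lengths w a b (size s).
Proof.
move=> ps ai sb; exists s => //; exists i; split=> //.
apply: sub_all (path_confined ps) => z /andP[iz zl].
by rewrite (le_trans ai iz) (le_trans zl sb).
Qed.

Lemma longest_ge (w : config) (a b i : int) (s : seq int) :
  path (edge w) i s -> a <= i -> last i s <= b -> (size s <= longest w a b)%N.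
Proof.
move=> ps ai sb.
have ilast : i <= last i s.
  by apply: le_trans (path_size_le ps); rewrite lerDl.
have [_ ub] := longestP w (le_trans ai (le_trans ilast sb)).
by rewrite -leEnat; apply: ub; apply: path_lengths_size sb.
Qed.

Lemma longest_path (w : config) (a b : int) : a <= b ->
  exists i s, [/\ path (edge w) i s, a <= i, last i s <= b &
    size s = longest w a b].
Proof.
move=> ab; have [[s [i [ps sab]] sE] _] := longestP w ab.
exists i, s; split=> //; move/allP: sab => sab.
  by have /andP[] := sab i (mem_head _ _).
by have /andP[] := sab (last i s) (mem_last _ _).
Qed.

Lemma longest_refl (w : config) (a : int) : longest w a a = 0%N.
Proof.
have [i [s [/path_size_le]]] := longest_path w (lexx a).
by lia.
Qed.

Lemma path_nonempty (i : int) (s : seq int) : i < last i s -> (0 < size s)%N.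
Proof. by case: s => //=; rewrite ltxx. Qed.

(** * Additivity at skeleton points *)

Lemma longest_path_to (w : config) (a x : int) : a <= x -> skeleton w x ->
  exists i s, [/\ path (edge w) i s, a <= i, last i s = x &
    size s = longest w a x].
Proof.
move=> ax [_ tox]; have [i [s [ps ai sx sE]]] := longest_path w ax.
exists i, s; split=> //; apply/eqP; rewrite eq_le sx leNgt; apply/negP => lx.
have [t [pt tE]] := tox _ lx.
(* If the path stopped before [x], appending the nonempty path [t] would give a path in the same
   interval that beats the maximum. *)
have := @longest_ge w a x i (s ++ t).
rewrite cat_path ps pt last_cat tE lexx size_cat sE => /(_ isT ai isT).
have := @path_nonempty (last i s) t; rewrite tE => /(_ lx).
by lia.
Qed.

Lemma longest_path_from (w : config) (x b : int) : x <= b -> skeleton w x ->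
  exists s, [/\ path (edge w) x s, last x s <= b & size s = longest w x b].
Proof.
move=> xb [fromx _]; have [i [s [ps xi sb sE]]] := longest_path w xb.
suff ix : i = x by rewrite ix in ps sb; exists s; split.
apply/eqP; rewrite eq_le xi andbT leNgt; apply/negP => ltxi.
have [t [pt tE]] := fromx _ ltxi.
have := @longest_ge w x b x (t ++ s).
rewrite cat_path pt last_cat tE ps lexx size_cat sE => /(_ isT isT sb).
have := @path_nonempty x t; rewrite tE => /(_ ltxi).
by lia.
Qed.

(** Follow the path while it stays at or below [x]. If an edge jumps over [x], replace it by a path
    to [x] and a path from [x], which together have at least two edges. If the path ends before [x],
    it is extended to [x]; this is why the bound on the endpoint is a maximum. *)
Lemma reroute_path (w : config) (x i : int) (s : seq int) :
    skeleton w x -> path (edge w) i s -> i <= x ->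
  exists s1 s2, [/\ path (edge w) i s1, last i s1 = x, path (edge w) x s2,
    last x s2 <= Num.max x (last i s) & (size s <= size s1 + size s2)%N].
Proof.
move=> [fromx tox]; elim: s i => [|k s IHs] i /=.
  move=> _; rewrite le_eqVlt => /predU1P[->|/tox[s1 [ps1 s1E]]].
    by exists [::], [::]; split; rewrite //= maxxx.
  by exists s1, [::]; split; rewrite //= ?le_max ?lexx.
case/andP => ik ps; have [kx _|xk] := leP k x.
  have [s1 [s2 [ps1 s1E ps2 s2l sz]]] := IHs _ ps kx.
  by exists (k :: s1), s2; split; rewrite //= ik.
rewrite le_eqVlt => /predU1P[ix|ix].
  exists [::], (k :: s); rewrite /= -ix ik ps; split=> //.
  by rewrite le_max lexx orbT.
have [s1 [ps1 s1E]] := tox _ ix; have [t [pt tE]] := fromx _ xk.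
exists s1, (t ++ s); rewrite cat_path last_cat tE pt ps; split=> //.
  by rewrite le_max lexx orbT.
have := @path_nonempty i s1; rewrite s1E => /(_ ix).
have := @path_nonempty x t; rewrite tE => /(_ xk).
by rewrite size_cat; lia.
Qed.

Lemma longest_skeleton (w : config) (a x b : int) :
    a <= x -> x <= b -> skeleton w x ->
  longest w a b = (longest w a x + longest w x b)%N.
Proof.
move=> ax xb Sx; apply/eqP; rewrite eqn_leq; apply/andP; split; last first.
  have [i [s [ps ai sE <-]]] := longest_path_to ax Sx.
  have [t [pt tb <-]] := longest_path_from xb Sx.
  by rewrite -size_cat (@longest_ge _ _ _ i)// ?cat_path ?last_cat sE ?ps.
have [i [s [ps ai sb <-]]] := longest_path w (le_trans ax xb).
have [ix|xi] := leP i x.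
  have [s1 [s2 [ps1 s1E ps2 s2l sz]]] := reroute_path Sx ps ix.
  apply: leq_trans sz (leq_add _ _).
    by apply: longest_ge ps1 ai _; rewrite s1E.
  by apply: longest_ge ps2 _ _ => //; rewrite (le_trans s2l)// ge_max xb.
(* The path lies entirely to the right of [x]: prefixed by a path from [x], it is already bounded by
   the term for [x] and [b]. *)
have [fromx _] := Sx; have [t [pt tE]] := fromx _ xi.
apply: leq_trans (leq_addl _ _); apply: (@leq_trans (size (t ++ s))).
  by rewrite size_cat leq_addl.
by apply: (@longest_ge _ _ _ x); rewrite ?cat_path ?last_cat ?tE ?pt.
Qed.

Lemma longest_skeleton_sum (w : config) (G : int -> int) (m : int) (N : nat) :
    {homo G : m n / m < n} -> (forall n, skeleton w (G n)) ->
  longest w (G m) (G (m + N%:Z)) =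
    (\sum_(0 <= k < N) longest w (G (m + k%:Z)%R) (G (m + k%:Z + 1)%R))%N.
Proof.
move=> Gmono GS; have Gle := ltW_homo Gmono.
elim: N => [|N IHN]; first by rewrite addr0 longest_refl big_nil.
rewrite big_nat_recr//= -IHN -(@longest_skeleton _ _ (G (m + N%:Z)))//.
- by congr (longest _ _ (G _)); lia.
- by apply: Gle; lia.
- by apply: Gle; lia.
Qed.

(** * Enumeration of a set of integers unbounded in both directions *)

Lemma int_set_min (A : set int) (b : int) :
    (exists n, A n) -> (forall n, A n -> b <= n) ->
  exists n, A n /\ forall k, A k -> n <= k.
Proof.
move=> [n An] Ab.
have exA : exists k : nat, `[< A (b + k%:Z) >].
  exists `|n - b|%N; apply/asboolP; have := Ab _ An => bn.
  by rewrite (_ : b + _ = n)//; lia.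
case: (ex_minnP exA) => k /asboolP Ak kmin; exists (b + k%:Z); split=> // l Al.
have bl := Ab _ Al; have := kmin `|l - b|%N.
rewrite (_ : b + _ = l); last by lia.
by move=> /(_ (asboolT Al)); lia.
Qed.

(** [g] iterates the map sending a point to the next element of [S]. *)
Lemma enum_above (S : set int) (a : int) :
    S a -> (forall N, exists n, N < n /\ S n) ->
  exists g : nat -> int, [/\ g 0%N = a, {homo g : m n / (m < n)%N >-> m < n},
    forall n, S (g n) & forall x, S x -> a <= x -> exists n, g n = x].
Proof.
move=> Sa Sunb.
have /choice[next nextP] x : exists y, [/\ S y, x < y &
    forall z, S z -> x < z -> y <= z].
  have [n [xn Sn]] := Sunb x.
  have [|k [_ /ltW]|y [[Sy xy] ymin]] := @int_set_min [set z | S z /\ x < z] x.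
  - by exists n.
  - by [].
  - by exists y; split=> // z Sz xz; apply: ymin.
pose g n := iter n next a; exists g.
have gS n : S (g n) by case: n => [//|n]; have [] := nextP (g n).
have gmono : {homo g : m n / (m < n)%N >-> m < n}.
  by apply: homo_ltn => [|n]; [exact: lt_trans|have [] := nextP (g n)].
split=> // x Sx ax.
have grow n : a + n%:Z <= g n.
  elim: n => [|n IHn]; first by rewrite addr0.
  by have := gmono n n.+1 (ltnSn n); lia.
have exn : exists n, x < g n.
  by exists `|x - a|.+1; have := grow `|x - a|.+1; lia.
(* At the first index where [g] exceeds [x], the previous value is at most [x], and no element of
   [S] lies strictly between these two values. Index 0 is excluded because [g] starts at
   [a <= x]. *)
case: (ex_minnP exn) => -[|n] xg nmin.
  by move: xg; rewrite /g /= ltNge ax.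
exists n; apply/eqP.
rewrite eq_le; apply/andP; split; rewrite leNgt; apply/negP.
  by move=> /nmin; rewrite ltnn.
have [_ _ gmin] := nextP (g n); move=> /(gmin _ Sx).
by rewrite leNgt xg.
Qed.

Lemma skeleton_enum_exists (w : config) :
    (forall N, exists n, N < n /\ skeleton w n) ->
    (forall N, exists n, N < - n /\ skeleton w n) ->
  exists G, skeleton_enum w G.
Proof.
set S := skeleton w => Sup Sdown.
pose T : set int := [set n | S (- n)].
have Tup N : exists n, N < n /\ T n.
  by have [n [Nn Sn]] := Sdown N; exists (- n); rewrite /T /= opprK.
(* [- b] is the largest skeleton point that is at most 0; it becomes [G 0]. The points below it are
   enumerated through the reflected set [T]. *)
have [||b [[Tb b0] bmin]] := @int_set_min [set n | T n /\ 0 <= n] 0.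
- by have [n [n0 Tn]] := Tup 0; exists n; split=> //; exact: ltW.
- by move=> n [].
have [g [g0 gmono gS gsurj]] := @enum_above S (- b) Tb Sup.
have [h [h0 hmono hT hsurj]] := @enum_above T b Tb Tup.
(* [Negz k] is [- (k + 1)], hence the index [k.+1]: the value [h 0 = b] would repeat [G 0]. *)
pose G (n : int) := match n with Posz k => g k | Negz k => - h k.+1 end.
exists G; split.
- move=> [m|m] [n|n] mn //=.
  + exact: gmono.
  + have := hmono 0%N m.+1 isT; rewrite h0.
    have : g 0%N <= g n by apply: (ltW_homo gmono); rewrite leEnat.
    by rewrite g0; lia.
  + by rewrite ltrN2; apply: hmono; lia.
- apply/seteqP; split=> [_ [[n|n] _ <-]|x Sx]; [exact: gS|exact: hT|].
  have [bx|xb] := leP (- b) x.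
    by have [n gn] := gsurj x Sx bx; exists n%:Z.
  have [||[|n] hn] := hsurj (- x).
  + by rewrite /T /= opprK.
  + by lia.
  + by move: hn xb; rewrite h0; lia.
  + by exists (Negz n) => //=; lia.
- rewrite /= g0; apply/andP; split; first by lia.
  (* Were [g 1] at most 0, it would be a skeleton point in the range where [- b] is the largest. *)
  rewrite ltNge; apply/negP => g1; have := gmono 0%N 1%N isT; rewrite g0.
  have : b <= - g 1%N by apply: bmin; split; rewrite /T /= ?opprK//; lia.
  by lia.
Qed.

(** * Effect of the shift on the skeleton *)

Lemma edge_shift (w : config) (i j : int) :
  edge (Defs.shift w) i j = edge w (i + 1) (j + 1).
Proof.
have [ij|ji] := ltP i j; last first.
  by apply/idP/idP => /edge_lt; rewrite ?ltrD2r ltNge ji.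
have ij1 : i + 1 < j + 1 by rewrite ltrD2r.
rewrite (edgeE _ ij) (edgeE _ ij1) /Defs.shift /=.
by congr w; apply: val_inj.
Qed.

Lemma leads_shift (w : config) (i j : int) :
  leads (Defs.shift w) i j <-> leads w (i + 1) (j + 1).
Proof.
pose f (k : int) := k + 1.
have pE s : path (edge (Defs.shift w)) i s = path (edge w) (f i) (map f s).
  by rewrite path_map; apply: eq_path => k l /=; rewrite edge_shift.
split=> [[s [ps <-]]|[s [ps sE]]].
  by exists (map f s); rewrite (last_map f) -pE.
have fK : map f (map (fun k => k - 1) s) = s.
  by rewrite -map_comp map_id_in// => k _ /=; rewrite /f subrK.
exists (map (fun k => k - 1) s); rewrite pE fK; split=> //.
by apply: (addIr 1); rewrite -sE -[in RHS]fK (last_map f).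
Qed.

Lemma skeleton_shift (w : config) (n : int) :
  skeleton (Defs.shift w) n <-> skeleton w (n + 1).
Proof.
split=> -[Sr Sl]; split=> j nj.
- by rewrite -[j](subrK 1); apply/leads_shift; apply: Sr; lia.
- by rewrite -[j](subrK 1); apply/leads_shift; apply: Sl; lia.
- by apply/leads_shift; apply: Sr; lia.
- by apply/leads_shift; apply: Sl; lia.
Qed.

(** * Almost sure unboundedness of the skeleton *)

Definition skeleton_beyond (c N : int) : set config_space :=
  \bigcup_(n in [set n | N < c * n]) [set w : config_space | skeleton w n].

(* [c = 1] and [c = -1] give unboundedness above and below. *)
Definition skeleton_unbounded (c : int) : set config_space :=
  [set w : config_space | forall N, exists n, N < c * n /\ skeleton w n].

Lemma measurable_skeleton_beyond (c N : int) :
  measurable (skeleton_beyond c N).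
Proof.
rewrite /skeleton_beyond bigcup_mkcond.
apply: countable_bigcupT_measurable => [|n]; first exact: countableP.
by case: ifP => _; [exact: measurable_skeleton|exact: measurable0].
Qed.

(** Natural thresholds suffice, which presents the event as the limit of a decreasing sequence,
    ready for continuity from above. *)
Lemma skeleton_unboundedE (c : int) :
  skeleton_unbounded c = \bigcap_N skeleton_beyond c (Posz N).
Proof.
apply/seteqP; split=> w Sw.
  by move=> N _; have [n [Nn Sn]] := Sw N%:Z; exists n.
move=> N; have [n /= Nn Sn] := Sw `|N|%N I.
by exists n; split=> //; lia.
Qed.

Lemma measurable_skeleton_unbounded (c : int) :
  measurable (skeleton_unbounded c).
Proof.
rewrite skeleton_unboundedE.
by apply: bigcap_measurableType => N _; apply: measurable_skeleton_beyond.
Qed.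

Lemma skeleton_unbounded_shift (c : int) :
  Defs.shift @^-1` skeleton_unbounded c = skeleton_unbounded c.
Proof.
apply/seteqP; split=> w Sw N.
  (* Moving a skeleton point by one changes [c * n] by [c]; the arbitrary threshold absorbs this. *)
  have [n [Nn /skeleton_shift Sn]] := Sw (N - c).
  by exists (n + 1); split=> //; lia.
have [n [Nn Sn]] := Sw (N + c).
exists (n - 1); split; first by lia.
by apply/skeleton_shift; rewrite subrK.
Qed.

Lemma probability_skeleton (R : realType) (P : probability config_space R)
    (n : int) : shift_invariant P ->
  P [set w : config_space | skeleton w n] =
  P [set w : config_space | skeleton w 0].
Proof.
move=> Pinv.
have step k : P [set w : config_space | skeleton w (k + 1)] =
              P [set w : config_space | skeleton w k].
  rewrite -(Pinv _ (measurable_skeleton k)); congr (P _).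
  by apply/seteqP; split=> w Sw; apply/skeleton_shift.
elim/int_ind: n => [//|n IHn|n IHn].
  by rewrite -IHn -(step n%:Z) (_ : n%:Z + 1 = n.+1%:Z)//; lia.
by rewrite -IHn -(step (- n.+1%:Z)) (_ : - n.+1%:Z + 1 = - n%:Z)//; lia.
Qed.

Lemma ae_skeleton_unbounded (R : realType) (P : probability config_space R)
    (c : int) : c * c = 1 -> shift_invariant P -> shift_ergodic P ->
    (0 < P [set w : config_space | skeleton w 0%R])%E ->
  {ae P, forall w, skeleton_unbounded c w}.
Proof.
move=> cc Pinv Perg P0.
have mE := measurable_skeleton_unbounded c.
have Pcvg : P (skeleton_beyond c (Posz N)) @[N --> \oo] -->
    P (skeleton_unbounded c).
  rewrite skeleton_unboundedE; apply: nonincreasing_cvg_mu.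
  - by rewrite (le_lt_trans (probability_le1 _ _)) ?ltry//;
      exact: measurable_skeleton_beyond.
  - by move=> N; exact: measurable_skeleton_beyond.
  - by rewrite -skeleton_unboundedE.
  - move=> M N MN; apply/subsetPset => w [n /= Nn Sn].
    by exists n => //=; lia.
have Ppos : (0 < P (skeleton_unbounded c))%E.
  apply: (lt_le_trans P0); rewrite -(cvg_lim _ Pcvg)//.
  apply: lime_ge; first by apply/cvg_ex; exists (P (skeleton_unbounded c)).
  (* As [c * c = 1], the point [c * (N + 1)] lies beyond [N] in direction [c], and by invariance it
     is in the skeleton with the same probability as 0. This bounds every term of the sequence from
     below. *)
  apply: nearW => N; rewrite -(@probability_skeleton _ _ (c * N.+1%:Z))//.
  apply: le_measure; rewrite ?inE.
  - exact: measurable_skeleton.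
  - exact: measurable_skeleton_beyond.
  - move=> w Sw; exists (c * N.+1%:Z) => //=.
    by rewrite mulrA cc mul1r; lia.
(* Ergodicity leaves only 0 and 1, and positivity rules out 0. *)
have PE : P (skeleton_unbounded c) = 1%E.
  case: (Perg _ mE (skeleton_unbounded_shift c)) => // P00.
  by rewrite P00 ltxx in Ppos.
exists (~` skeleton_unbounded c); split=> //; first exact: measurableC.
by rewrite probability_setC// PE subee.
Qed.

Theorem lemma3 (R : realType) (P : probability config_space R)
    (P_invariant : shift_invariant P) (P_ergodic : shift_ergodic P)
    (P_skeleton0 : (0 < P [set w : config_space | skeleton w 0%R])%E) :
  {ae P, forall w : config_space,
    (exists G : int -> int, skeleton_enum w G) /\
    (forall G : int -> int, skeleton_enum w G ->
      forall m n : int, m < n ->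
        longest w (G m) (G n) =
        (\sum_(0 <= k < `|n - m|)
           longest w (G (m + k%:Z)%R) (G (m + k%:Z + 1)%R))%N)}.
Proof.
have up := @ae_skeleton_unbounded R P 1 (mulr1 1) P_invariant P_ergodic
  P_skeleton0.
have down := @ae_skeleton_unbounded R P (-1) (mulrNN 1 1) P_invariant P_ergodic
  P_skeleton0.
apply: filterS2 up down => w up down; split.
  apply: skeleton_enum_exists => N.
    by have [n] := up N; rewrite mul1r; exists n.
  by have [n] := down N; rewrite mulN1r; exists n.
move=> G [Gmono Grange _] m n mn; rewrite -longest_skeleton_sum//.
  by rewrite gez0_abs ?subr_ge0 ?ltW// subrKC.
by move=> k; rewrite -Grange; exists k.
Qed.
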